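(* Let $T_n(X_1,\dots,X_n)$ and $f_n(X_1,\dots,X_n)$ denote the polynomials with rational coefficients that express the symmetric polynomials $T_n(\boldsymbol{x}^k)$ and $f_n(\boldsymbol{x}^k)$ defined in the context in terms of power sums, i.e. $T_n(\boldsymbol{x}^k)=T_n(p_1,\dots,p_n)$ and $f_n(\boldsymbol{x}^k)=f_n(p_1,\dots,p_n)$ for all $k\ge1$. If $n\ge2$, then $$T_n(p_1,p_2,p_3,p_4,\dots,p_n)=f_n\big(p_1,-p_2,p_3,-p_4,\dots,(-1)^{n-1}p_n\big).$$
   Context: Let $\boldsymbol{x}^k=(x_1,\dots,x_k)$ and $p_j=p_j(\boldsymbol{x}^k)=x_1^j+\cdots+x_k^j$. Definition of $T_n$. For $N\ge 1$ let $$P_N(\boldsymbol{x}^k)=\sum_{\emptyset\ne S\subseteq\{1,\dots,k\}}(-1)^{|S|-1}\Big(\sum_{j\in S}x_j\Big)^N.$$ The polynomial $T_n(\boldsymbol{x}^k)$, $n\ge0$, is defined by $$P_{n+k}(\boldsymbol{x}^k)=(-1)^{k+1}\frac{(n+k)!}{n!}\,x_1x_2\cdots x_k\;T_n(\boldsymbol{x}^k),$$ with $T_0=1$. Definition of $f_n$. Let $B_n$ be the Bernoulli numbers, $\frac{z}{e^z-1}=\sum_{n\ge0}B_n\frac{z^n}{n!}$ (so $B_1=-\tfrac12$). Umbrally, $$f_n(\boldsymbol{x}^k)=\Big(p_1+\sum_{i=1}^k\mathcal B_ix_i\Big)^n,$$ meaning: expand the right-hand side as a polynomial in independent commuting symbols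 $\mathcal B_1,\dots,\mathcal B_k$ and then replace each monomial $\mathcal B_1^{a_1}\cdots\mathcal B_k^{a_k}$ by $B_{a_1}\cdots B_{a_k}$. Both $T_n(\boldsymbol{x}^k)$ and $f_n(\boldsymbol{x}^k)$ are given by polynomials in $p_1,\dots,p_n$ whose coefficients do not depend on $k$; these polynomials in $n$ indeterminates are unique. For example $T_2=\frac{3p_1^2+p_2}{12}$ and $f_2=\frac{3p_1^2-p_2}{12}$. *)

(* Defs.v *)
From HB Require Import structures.
From mathcomp Require Import all_boot all_order all_algebra.
From mathcomp.multinomials Require Import mpoly.

Set Implicit Arguments.
Unset Strict Implicit.
Unset Printing Implicit Defensive.

Import GRing.Theory.
Local Open Scope ring_scope.

(* The variables x_1, ..., x_k are 'X_i for i : 'I_k, numbered from 0. *)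

Definition powersum (k j : nat) : {mpoly rat[k]} := \sum_(i < k) 'X_i ^+ j.

Definition P_poly (k N : nat) : {mpoly rat[k]} :=
  \sum_(S : {set 'I_k} | S != set0)
     (-1) ^+ (#|S| - 1) * (\sum_(j in S) 'X_j) ^+ N.

(* T_n(x^k) is defined implicitly: it is the cofactor of
   (-1)^(k+1) (n+k)!/n! x_1 ... x_k in P_(n+k)(x^k). *)
Definition is_T (k n : nat) (t : {mpoly rat[k]}) : Prop :=
  P_poly k (n + k) =
    ((-1) ^+ k.+1 * ((n + k)`!%:R / n`!%:R)) *: ((\prod_(i < k) 'X_i) * t).

Lemma is_T_unique (k n : nat) (t u : {mpoly rat[k]}) :
  is_T n t -> is_T n u -> t = u.
Proof.
rewrite /is_T => -> /eqP; rewrite -subr_eq0 -scalerBr -mulrBr scaler_eq0.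
rewrite !mulf_eq0 invr_eq0 signr_eq0 !Num.Theory.pnatr_eq0.
rewrite !eqn0Ngt !fact_gt0 /=.
have /negPf -> : (\prod_(i < k) 'X_i : {mpoly rat[k]}) != 0.
  apply/prodf_neq0 => i _; apply/eqP => /(congr1 (mcoeff U_(i)%MM)) /eqP.
  by rewrite mcoeffX eqxx mcoeff0 oner_eq0.
by rewrite /= subr_eq0 => /eqP.
Qed.

(* Coefficient of z^j in e^z - 1. *)
Definition expm1_coef (j : nat) : rat := if j == 0%N then 0 else j`!%:R^-1.

Fixpoint bernoulli_seq (n : nat) : seq rat :=
  if n is m.+1 then
    let s := bernoulli_seq m in
    rcons s (m`!%:R * ((m == 0%N)%:R
               - \sum_(i < m) expm1_coef (m.+1 - i) * (s`_i / i`!%:R)))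
  else [::].

Definition bernoulli (n : nat) : rat := (bernoulli_seq n.+1)`_n.

(* (e^z - 1) * \sum_i B_i z^i / i! = z as formal power series in z. *)
Lemma bernoulliP (n : nat) :
  \sum_(i < n.+1) expm1_coef (n - i) * (bernoulli i / i`!%:R) = (n == 1%N)%:R.
Proof.
have szs m : size (bernoulli_seq m) = m.
  by elim: m => //= m IHm; rewrite size_rcons IHm.
have nths m i : (i < m)%N -> (bernoulli_seq m)`_i = bernoulli i.
  elim: m => // m IHm; rewrite ltnS leq_eqVlt => /predU1P[-> // | lt_im].
  by rewrite /= nth_rcons szs lt_im IHm.
rewrite big_ord_recr /= subnn mul0r addr0.
case: n => [|n]; first by rewrite big_ord0.
rewrite big_ord_recr /= subSnn {2}/bernoulli /= nth_rcons szs ltnn eqxx.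
have fn0 : n`!%:R != 0 :> rat.
  by rewrite Num.Theory.pnatr_eq0 -lt0n fact_gt0.
have -> : expm1_coef 1 = 1 by rewrite /expm1_coef /= invr1.
rewrite mul1r [X in _ + X]mulrC mulKf // eqSS.
under [X in _ + (_ - X)]eq_bigr => i _ do rewrite nths //.
by rewrite addrC subrK.
Qed.

(* Polynomials in the symbols B_1, ..., B_k with coefficients in Q[x_1,...,x_k]
   are {mpoly {mpoly rat[k]}[k]}; umbra is the Q[x]-linear map sending the
   monomial with exponents a_1, ..., a_k to B_(a_1) ... B_(a_k). *)
Definition umbra (k : nat) (q : {mpoly {mpoly rat[k]}[k]}) : {mpoly rat[k]} :=
  \sum_(m <- msupp q) (\prod_(i < k) bernoulli (m i)) *: q@_m.

Definition f_poly (k n : nat) : {mpoly rat[k]} :=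
  umbra (((powersum k 1)%:MP + \sum_(i < k) 'X_i * ('X_i)%:MP) ^+ n).

(* The indeterminate 'X_i of {mpoly rat[n]} stands for p_(i+1). *)
Definition at_powersums (n k : nat) (Q : {mpoly rat[n]}) : {mpoly rat[k]} :=
  Q \mPo [tuple powersum k i.+1 | i < n].

Definition expresses_T (n : nat) (Q : {mpoly rat[n]}) : Prop :=
  forall k : nat, (0 < k)%N -> is_T n (at_powersums k Q).

Definition expresses_f (n : nat) (Q : {mpoly rat[n]}) : Prop :=
  forall k : nat, (0 < k)%N -> f_poly k n = at_powersums k Q.

(* Q(p_1, -p_2, p_3, ..., (-1)^(n-1) p_n); 'X_i is p_(i+1), hence (-1)^i. *)
Definition alternate_signs (n : nat) (Q : {mpoly rat[n]}) : {mpoly rat[n]} :=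
  Q \mPo [tuple (-1) ^+ i * 'X_i | i < n].

(* Main.v *)
Require Import Defs.
From mathcomp Require Import all_boot all_order all_algebra.
From mathcomp.multinomials Require Import mpoly.
From mathcomp.multinomials Require ssrcomplements.
From mathcomp Require Import ring.

(** Let E(u) = (e^u - 1) / u, let log E be its logarithm, and let d_j be the
    coefficients of u E'(u) / E(u).

    Inclusion-exclusion turns the sum over subsets S that defines P_N into the
    coefficient of z^N in 1 - \prod_i (1 - e^(x_i z)), and factoring -x_i z out of
    each factor shows that T_n / n! is the coefficient of z^n in
    \prod_i E(x_i z) ([is_T_coef]).  Since the Bernoulli umbra sends e^(B u) to
    u / (e^u - 1) and the k symbols are independent, f_n / n! is the coefficient
    of z^n in e^(p_1 z) \prod_i x_i z / (e^(x_i z) - 1), that is, in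
    \prod_i x_i z / (1 - e^(- x_i z)) = \prod_i 1 / E(- x_i z)
    ([f_poly_coef], [todd_expquoN]).

    Taking logarithms, the first product is exp (\sum_j c_j p_j z^j) with
    c_j = d_j / j, and the second is exp (- \sum_j c_j p_j (-z)^j), which is the
    first one after p_j is replaced by (-1)^(j-1) p_j.  To stay with polynomials,
    logarithms are replaced by logarithmic derivatives: if h_m is the coefficient
    of z^m in exp (\sum_j c_j q_j z^j), then h_0 = 1 and
    m h_m = \sum_(j <= m) d_j q_j h_(m-j) ([logder_rec]).  The two products satisfy
    this recursion with q_j = p_j and q_j = (-1)^(j-1) p_j ([expquo_rec],
    [todd_rec]), and its solution is a universal polynomial Q_m in q_1, ..., q_m
    ([logder_rec_solution]).

    So n! Q_n expresses T_n, and n! Q_n with alternated signs expresses f_n, in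
    terms of power sums.  As p_1, ..., p_n are algebraically independent in n
    variables ([at_powersums_inj]), these are the given polynomials, and
    alternating signs is an involution. *)

Set Implicit Arguments.
Unset Strict Implicit.
Unset Printing Implicit Defensive.

Import GRing.Theory Num.Theory.
Local Open Scope ring_scope.

(** * Truncated power series *)

(** The series \sum_j a_j (x z)^j up to order N.  The coefficients a_j are
    rational because division by factorials is needed, while x ranges over a
    commutative Q-algebra, given by its structure morphism iota. *)
Definition ser (R : comNzRingType) (iota : {rmorphism rat -> R}) (N : nat)
    (a : nat -> rat) (x : R) : {poly R} :=
  \poly_(j < N.+1) (iota (a j) * x ^+ j).

Definition eqmodX (R : comNzRingType) (N : nat) (p q : {poly R}) : Prop :=
  forall i, (i <= N)%N -> p`_i = q`_i.

Section Series.
Context (R : comNzRingType) (iota : {rmorphism rat -> R}) (N : nat).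
Implicit Types (p q : {poly R}) (a b : nat -> rat) (x y : R).
Local Notation "p =X q" := (eqmodX N p q) (at level 70).
Local Notation ser := (ser iota N).

Lemma eqmodX_sym p q : p =X q -> q =X p.
Proof. by move=> h i iN; rewrite h. Qed.

Lemma eqmodX_trans q p r : p =X q -> q =X r -> p =X r.
Proof. by move=> h1 h2 i iN; rewrite h1 // h2. Qed.

Lemma eqmodXD p p' q q' : p =X p' -> q =X q' -> p + q =X p' + q'.
Proof. by move=> h1 h2 i iN; rewrite !coefD h1 // h2. Qed.

Lemma eqmodXM p p' q q' : p =X p' -> q =X q' -> p * q =X p' * q'.
Proof.
move=> h1 h2 i iN; rewrite !coefM; apply: eq_bigr => j _.
rewrite h1 ?h2 // (leq_trans _ iN) ?leq_subr //.
by rewrite -ltnS.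
Qed.

Lemma eqmodX_prod (I : Type) (r : seq I) (P : pred I) (F G : I -> {poly R}) :
  (forall i, P i -> F i =X G i) ->
  \prod_(i <- r | P i) F i =X \prod_(i <- r | P i) G i.
Proof. by move=> h; apply: (big_ind2 (eqmodX N)) => // *; apply: eqmodXM. Qed.

(** z d/dz; unlike d/dz it respects congruence modulo z^(N+1). *)
Definition euler_op p : {poly R} := 'X * p^`().

Lemma coef_euler_op p i : (euler_op p)`_i = p`_i *+ i.
Proof. by rewrite coefXM; case: i => [|i]; rewrite ?mulr0n //= coef_deriv. Qed.

Lemma euler_opM p q : euler_op (p * q) = euler_op p * q + p * euler_op q.
Proof. by rewrite /euler_op derivM mulrDr mulrA !(mulrCA 'X). Qed.

Lemma eqmodX_euler_op p q : p =X q -> euler_op p =X euler_op q.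
Proof. by move=> h i iN; rewrite !coef_euler_op h. Qed.

Lemma coef_ser a x i : (i <= N)%N -> (ser a x)`_i = iota (a i) * x ^+ i.
Proof. by move=> iN; rewrite coef_poly ltnS iN. Qed.

Lemma eq_ser a b x : (forall j, (j <= N)%N -> a j = b j) -> ser a x = ser b x.
Proof.
by move=> h; apply/polyP=> i; rewrite !coef_poly; case: ifP => // /h ->.
Qed.

Lemma serM a b x :
  ser a x * ser b x =X ser (fun n => \sum_(i < n.+1) a i * b (n - i)%N) x.
Proof.
move=> i iN; rewrite coefM coef_ser // rmorph_sum mulr_suml.
apply: eq_bigr => j _; have ji : (j <= i)%N by rewrite -ltnS.
rewrite !coef_ser ?(leq_trans ji) ?(leq_trans (leq_subr _ _)) //.
have -> : x ^+ i = x ^+ j * x ^+ (i - j) by rewrite -exprD subnKC.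
by rewrite rmorphM; ring.
Qed.

Lemma ser_euler_op a x : euler_op (ser a x) = ser (fun n => a n *+ n) x.
Proof.
apply/polyP=> i; rewrite coef_euler_op !coef_poly; case: ifP => _; last first.
  exact: mul0rn.
by rewrite rmorphMn /= mulrnAl.
Qed.

Lemma ser_delta x : ser (fun n => (n == 0)%:R) x = 1.
Proof.
apply/polyP=> i; rewrite coef_poly coef1; case: i => [|i] /=.
  by rewrite rmorph1 mulr1.
by case: ifP => // _; rewrite rmorph0 mul0r.
Qed.

Lemma serN a x : ser a (- x) = ser (fun n => (-1) ^+ n * a n) x.
Proof.
apply/polyP=> i; rewrite !coef_poly; case: ifP => // _.
by rewrite (exprNn x) rmorphM rmorph_sign; ring.
Qed.

(** D = z F' / F up to order N, written without dividing by F. *)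
Definition logder_rel (D F : {poly R}) : Prop := euler_op F =X D * F.

Lemma logder_prod (I : Type) (r : seq I) (P : pred I) (D F : I -> {poly R}) :
  (forall i, P i -> logder_rel (D i) (F i)) ->
  logder_rel (\sum_(i <- r | P i) D i) (\prod_(i <- r | P i) F i).
Proof.
move=> h; apply: (big_ind2 logder_rel) => //.
  move=> i _; rewrite coef_euler_op mul0r coef0 coef1.
  by case: i => [|i] //; rewrite mul0rn.
move=> D1 F1 D2 F2 h1 h2; rewrite /logder_rel euler_opM.
have -> : (D1 + D2) * (F1 * F2) = D1 * F1 * F2 + F1 * (D2 * F2) by ring.
by apply: eqmodXD; apply: eqmodXM.
Qed.

End Series.

(** * The series of e^u, (e^u - 1) / u and u / (e^u - 1) *)

Lemma fact_neq0 n : n`!%:R != 0 :> rat.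
Proof. by rewrite pnatr_eq0 -lt0n fact_gt0. Qed.

Lemma invf_fact_bin n j : (j <= n)%N ->
  j`!%:R^-1 * (n - j)`!%:R^-1 = n`!%:R^-1 * 'C(n, j)%:R :> rat.
Proof.
move=> jn; rewrite -invfM -natrM.
apply: (mulfI (fact_neq0 n)); rewrite mulVKf ?fact_neq0 //.
by rewrite -[in LHS](bin_fact jn) natrM mulfK // natrM mulf_neq0 ?fact_neq0.
Qed.

Definition exp_coef (j : nat) : rat := j`!%:R^-1.

(** E(u) = (e^u - 1) / u. *)
Definition expquo_coef (j : nat) : rat := j.+1`!%:R^-1.

(** u / (e^u - 1) = 1 / E(u). *)
Definition bern_coef (j : nat) : rat := bernoulli j / j`!%:R.

(** u E'(u) / E(u), computed as the product of u E'(u) and 1 / E(u). *)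
Definition logder_coef (n : nat) : rat :=
  \sum_(i < n.+1) (expquo_coef i *+ i) * bern_coef (n - i).

Lemma bern_expquo_conv n :
  \sum_(i < n.+1) bern_coef i * expquo_coef (n - i) = (n == 0)%:R.
Proof.
rewrite -eqSS -(bernoulliP n.+1) [RHS]big_ord_recr /= subnn mul0r addr0.
apply: eq_bigr => i _; rewrite subSn -1?ltnS // mulrC.
by rewrite /expm1_coef.
Qed.

(** e^u E(-u) = E(u): after multiplication by (n+1)!, this is the expansion of
    (-1 + 1)^(n+1) = 0 with its last term isolated. *)
Lemma exp_expquoN_conv n :
  \sum_(i < n.+1) exp_coef i * ((-1) ^+ (n - i) * expquo_coef (n - i)) =
  expquo_coef n.
Proof.
have /esym := exprDn (-1) (1 : rat) n.+1.
rewrite addNr expr0n big_ord_recr /= subnn expr1n binn => /eqP.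
rewrite addr_eq0 expr0 mulr1 mulr1n => /eqP s.
rewrite -[RHS]mulr1 -[X in _ = _ * X](opprK 1) -[X in _ = _ * - X]s.
rewrite -sumrN mulr_sumr; apply: eq_bigr => i _.
have iN : (i <= n)%N by rewrite -ltnS.
rewrite mulrCA /expquo_coef -subSn // invf_fact_bin ?leqW // subSn // expr1n.
rewrite exprS; ring.
Qed.

Lemma expquo_coef0 : expquo_coef 0 = 1.
Proof. by []. Qed.

Lemma bern_coef0 : bern_coef 0 = 1.
Proof. by have := bern_expquo_conv 0; rewrite big_ord1 expquo_coef0 mulr1. Qed.

(** This vanishing keeps p_0 = k, and with it the number of variables, out of
    the recursion for the coefficients of the generating functions. *)
Lemma logder_coef0 : logder_coef 0 = 0.
Proof. by rewrite /logder_coef big_ord1 mulr0n mul0r. Qed.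

Section ConcreteSeries.
Context (R : comNzRingType) (iota : {rmorphism rat -> R}) (N : nat).
Implicit Types (x y : R).
Local Notation "p =X q" := (eqmodX N p q) (at level 70).
Local Notation ser := (ser iota N).

Lemma ser_bern_expquo x : ser bern_coef x * ser expquo_coef x =X 1.
Proof.
apply: eqmodX_trans (serM _ _ _ _) _; rewrite -(ser_delta iota N x).
rewrite (eq_ser _ (b := fun n => (n == 0)%:R)) // => n _.
exact: bern_expquo_conv.
Qed.

Lemma logder_expquo x : logder_rel N (ser logder_coef x) (ser expquo_coef x).
Proof.
rewrite /logder_rel ser_euler_op; apply: eqmodX_sym.
apply: (@eqmodX_trans _ _
  (ser (fun n => expquo_coef n *+ n) x * ser bern_coef x * ser expquo_coef x)).
  by apply: eqmodXM => //; apply/eqmodX_sym/serM.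
rewrite -mulrA -[X in _ =X X]mulr1; apply: eqmodXM => //.
exact: ser_bern_expquo.
Qed.

Lemma ser_expD x y : ser exp_coef x * ser exp_coef y =X ser exp_coef (x + y).
Proof.
move=> i iN; rewrite coefM coef_ser // addrC exprDn mulr_sumr.
apply: eq_bigr => j _; have ji : (j <= i)%N by rewrite -ltnS.
rewrite !coef_ser ?(leq_trans ji) ?(leq_trans (leq_subr _ _)) //.
rewrite -mulr_natr -(rmorph_nat iota) mulrACA -rmorphM /exp_coef.
rewrite invf_fact_bin // rmorphM; ring.
Qed.

Lemma ser_exp0 : ser exp_coef 0 = 1.
Proof.
apply/polyP=> i; rewrite coef_poly coef1; case: i => [|i] /=.
  by rewrite /exp_coef fact0 invr1 rmorph1 mulr1.
by case: ifP => // _; rewrite expr0n mulr0.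
Qed.

Lemma ser_exp_sum (I : Type) (r : seq I) (P : pred I) (F : I -> R) :
  \prod_(i <- r | P i) ser exp_coef (F i)
    =X ser exp_coef (\sum_(i <- r | P i) F i).
Proof.
apply: (big_ind2 (fun p x => p =X ser exp_coef x)) => //.
  by rewrite ser_exp0.
move=> p x q y hp hq; apply: eqmodX_trans (ser_expD _ _).
exact: eqmodXM.
Qed.

Lemma ser_exp_expquoN x :
  ser exp_coef x * ser expquo_coef (- x) =X ser expquo_coef x.
Proof.
rewrite serN; apply: eqmodX_trans (serM _ _ _ _) _.
by rewrite (eq_ser _ (b := expquo_coef)) // => n _; apply: exp_expquoN_conv.
Qed.

(** u / (1 - e^(-u)), the generating function of the Todd class. *)
Definition todd x : {poly R} := ser exp_coef x * ser bern_coef x.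

Lemma coef0_todd x : (todd x)`_0 = 1.
Proof.
rewrite coefM big_ord1 !coef_ser // !expr0 !mulr1 -rmorphM bern_coef0 mulr1.
exact: rmorph1.
Qed.

Lemma todd_expquoN x : todd x * ser expquo_coef (- x) =X 1.
Proof.
rewrite /todd mulrAC.
apply: (@eqmodX_trans _ _ (ser expquo_coef x * ser bern_coef x)).
  by apply: eqmodXM => //; apply: ser_exp_expquoN.
by rewrite mulrC; apply: ser_bern_expquo.
Qed.

(** As todd (u) = 1 / E(-u), its logarithmic derivative is the opposite of that of
    E(-u).  Differentiating G(u) E(-u) = 1 gives (z G' + D G) E(-u) = 0, and
    multiplying by G cancels E(-u). *)
Lemma logder_todd x : logder_rel N (- ser logder_coef (- x)) (todd x).
Proof.
rewrite /logder_rel; set G := todd x; set E := ser expquo_coef (- x).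
set D := ser logder_coef (- x).
have GE : G * E =X 1 := todd_expquoN x.
have tE : euler_op E =X D * E := logder_expquo (- x).
have t0 : euler_op G * E + G * (D * E) =X 0.
  have <- : euler_op (1 : {poly R}) = 0 by rewrite /euler_op derivC mulr0.
  apply: (eqmodX_trans _ (eqmodX_euler_op GE)); rewrite euler_opM.
  by apply: eqmodXD => //; apply: eqmodXM => //; apply: eqmodX_sym.
have h : G * (euler_op G * E + G * (D * E)) =X 0.
  by rewrite -[X in _ =X X](mulr0 G); apply: eqmodXM.
have h' : (euler_op G + D * G) =X 0.
  apply: (eqmodX_trans _ h); apply: eqmodX_sym.
  have -> : G * (euler_op G * E + G * (D * E)) =
    (euler_op G + D * G) * (G * E) by ring.
  by rewrite -[X in _ =X X]mulr1; apply: eqmodXM.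
by move=> i iN; have /eqP := h' i iN;
  rewrite coefD coef0 addr_eq0 mulNr coefN => /eqP.
Qed.

End ConcreteSeries.

(** * Generating functions of T_n and f_n *)

(** Expanding the product over subsets S turns each term into e^(z \sum_S x_j).
    The empty subset, absent from P_N, contributes only to z^0, hence N > 0. *)
Lemma P_poly_coef k N : (0 < N)%N ->
  P_poly k N = - (N`!%:R *:
    (\prod_(i < k) (1 - ser (@mpolyC k rat) N exp_coef 'X_i))`_N).
Proof.
move=> N_gt0; under eq_bigr => i _ do rewrite addrC.
rewrite bigA_distr coef_sum (bigD1 set0) //=.
rewrite [X in X + _](_ : _ = 0); last first.
  rewrite big1 => [|i _]; last by rewrite inE.
  by rewrite coef1 gtn_eqF.
rewrite add0r scaler_sumr -sumrN /P_poly; apply: eq_bigr => S S0.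
rewrite -big_mkcond prodrN; set E := \prod_(_ in _) _.
have -> : ((-1) ^+ #|S| * E)`_N = (-1) ^+ #|S| * E`_N.
  rewrite -signr_odd -[in RHS]signr_odd !mulr_sign.
  by case: odd; rewrite ?coefN.
have := @ser_exp_sum _ (@mpolyC k rat) N _ (index_enum _) (mem S)
  (fun i => 'X_i) N.
rewrite leqnn => /(_ isT) ->; rewrite coef_ser //.
rewrite mul_mpolyC -scalerAr scalerA mulfV ?fact_neq0 // scale1r.
move: S0; rewrite -card_gt0; case: #|S| => // m _.
by rewrite subn1 /= exprS mulN1r mulNr opprK.
Qed.

Lemma one_sub_ser_exp (R : comNzRingType) (iota : {rmorphism rat -> R}) N x :
  eqmodX N (1 - ser iota N exp_coef x)
        (- (x *: ('X * ser iota N expquo_coef x))).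
Proof.
move=> i iN; rewrite coefB coefN coefZ coefXM coef1.
case: i iN => [|i] iN.
  rewrite coef_ser // /exp_coef fact0 invr1 (rmorph1 iota) mulr1 /=.
  by rewrite subrr mulr0 oppr0.
rewrite sub0r /= (coef_ser _ _ _ iN) (coef_ser _ _ _ (ltnW iN)).
by rewrite exprS mulrCA.
Qed.

(** The truncation order is n + k because the product of the 1 - e^(x_i z) starts
    with z^k. *)
Lemma is_T_coef k n : (0 < k)%N ->
  is_T n (n`!%:R *:
    (\prod_(i < k) ser (@mpolyC k rat) (n + k) expquo_coef 'X_i)`_n).
Proof.
move=> k_gt0; rewrite /is_T P_poly_coef ?addn_gt0 ?k_gt0 ?orbT //.
have := @eqmodX_prod _ (n + k) _ (index_enum 'I_k) xpredT _ _
  (fun i _ => @one_sub_ser_exp _ (@mpolyC k rat) (n + k) 'X_i)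
  (n + k)%N (leqnn _).
move=> ->.
rewrite prodrN card_ord scaler_prod big_split /= prodr_const card_ord.
set H := \prod_(i < k) ser _ _ _ _; set x := \prod_(i < k) 'X_i.
have -> : ((-1) ^+ k * (x *: ('X^k * H)))`_(n + k) = (-1) ^+ k *: (x * H`_n).
  rewrite -signr_odd -[in RHS]signr_odd.
  case: odd; rewrite ?mul1r ?mulN1r ?coefN coefZ coefXnM ltnNge leq_addl;
    rewrite /= addnK.
    by rewrite expr1 scaleN1r.
  by rewrite expr0 scale1r.
rewrite -scalerAr !scalerA -scaleNr; congr (_ *: _).
by rewrite exprS mulrA mulfVK ?fact_neq0 //; ring.
Qed.

Lemma coef_prod_poly (R : comNzRingType) (k N m : nat) (c : 'I_k -> nat -> R) :
  (\prod_(i < k) \poly_(j < N) c i j)`_m =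
  \sum_(f : {ffun 'I_k -> 'I_N} | (\sum_i f i)%N == m) \prod_i c i (f i).
Proof.
under eq_bigr => i _ do rewrite poly_def.
rewrite bigA_distr_bigA coef_sum [RHS]big_mkcond; apply: eq_bigr => f _ /=.
rewrite scaler_prod -expr_sum coefZ coefXn eq_sym.
by case: eqP; rewrite ?mulr1 ?mulr0.
Qed.

Lemma prod_mpolyC_mulX (S : comNzRingType) (k : nat) (a x : 'I_k -> S)
    (e : 'I_k -> nat) :
  \prod_(i < k) ((a i)%:MP_[k] * ('X_i * (x i)%:MP_[k]) ^+ e i) =
  (\prod_(i < k) (a i * x i ^+ e i))%:MP_[k] * 'X_[[multinom e i | i < k]].
Proof.
rewrite mpolyXE_id rmorph_prod -big_split /=; apply: eq_bigr => i _.
by rewrite mnmE exprMn rmorphM rmorphXn /=; ring.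
Qed.

Section Umbra.
Context (k : nat).
Implicit Types (p q : {mpoly {mpoly rat[k]}[k]}) (c : {mpoly rat[k]}).

(** Replacing the support by a common index set makes umbra visibly linear. *)
Lemma umbraE d q : (msize q <= d)%N ->
  umbra q = \sum_(m : 'X_{1..k < d}) (\prod_(i < k) bernoulli (m i)) *: q@_m.
Proof.
move=> qd; rewrite /umbra (ssrcomplements.big_mksub 'X_{1..k < d}) //=;
  rewrite ?msupp_uniq //; last first.
  by move=> m /msize_mdeg_lt /leq_trans; apply.
by rewrite big_rmcond // => m /memN_msupp_eq0 ->; rewrite scaler0.
Qed.

Lemma umbra0 : umbra 0 = 0 :> {mpoly rat[k]}.
Proof. by rewrite /umbra msupp0 big_nil. Qed.

Lemma umbraD p q : umbra (p + q) = umbra p + umbra q.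
Proof.
pose d := maxn (msize (p + q)) (maxn (msize p) (msize q)).
rewrite !(@umbraE d) ?leq_max ?leqnn ?orbT // -big_split /=.
by apply: eq_bigr => m _; rewrite mcoeffD scalerDr.
Qed.

Lemma umbra_sum (I : Type) (r : seq I) (P : pred I)
    (F : I -> {mpoly {mpoly rat[k]}[k]}) :
  umbra (\sum_(i <- r | P i) F i) = \sum_(i <- r | P i) umbra (F i).
Proof. exact: (big_morph _ umbraD umbra0). Qed.

Lemma umbraCM c q : umbra (c%:MP * q) = c * umbra q.
Proof.
pose d := maxn (msize (c%:MP * q)) (msize q).
rewrite !(@umbraE d) ?leq_max ?leqnn ?orbT // mulr_sumr.
by apply: eq_bigr => m _; rewrite mcoeffCM scalerAr.
Qed.

Lemma umbraX (m : 'X_{1..k}) :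
  umbra 'X_[m] = (\prod_(i < k) bernoulli (m i))%:MP_[k].
Proof. by rewrite /umbra msuppX big_seq1 mcoeffX eqxx -alg_mpolyC. Qed.

Definition mpolyCC : {rmorphism rat -> {mpoly {mpoly rat[k]}[k]}} :=
  (@mpolyC k {mpoly rat[k]}) \o (@mpolyC k rat).

(** The symbols are independent, so the umbra of \prod_i e^(B_i x_i z) is the
    product of the umbrae, and each is \sum_j B_j (x_i z)^j / j!. *)
Lemma umbra_exp_prod N m :
  umbra (\prod_(i < k) ser mpolyCC N exp_coef ('X_i * ('X_i)%:MP))`_m =
  (\prod_(i < k) ser (@mpolyC k rat) N bern_coef 'X_i)`_m.
Proof.
rewrite !coef_prod_poly umbra_sum; apply: eq_bigr => f _.
pose mf := [multinom (f i : nat) | i < k].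
transitivity (umbra ((\prod_(i < k) ((exp_coef (f i))%:MP * 'X_i ^+ f i))%:MP
   * 'X_[mf])).
  by congr umbra; apply: prod_mpolyC_mulX.
rewrite umbraCM umbraX rmorph_prod -big_split /=; apply: eq_bigr => i _.
by rewrite mnmE /bern_coef /exp_coef rmorphM /=; ring.
Qed.

End Umbra.

Lemma f_poly_coef k n N : (n <= N)%N ->
  f_poly k n = n`!%:R *: (\prod_(i < k) todd (@mpolyC k rat) N 'X_i)`_n.
Proof.
move=> nN; rewrite /f_poly.
set y := fun i : 'I_k => 'X_i * ('X_i)%:MP : {mpoly {mpoly rat[k]}[k]}.
set a := (_%:MP).
have -> : (a + \sum_(i < k) y i) ^+ n = mpolyCC k n`!%:R *
    (ser (mpolyCC k) N exp_coef a *
     \prod_(i < k) ser (mpolyCC k) N exp_coef (y i))`_n.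
  rewrite (@eqmodX_trans _ N (ser (mpolyCC k) N exp_coef (a + \sum_(i < k) y i)) _
      (ser (mpolyCC k) N exp_coef (a + \sum_(i < k) y i)) _ _ n nN) //.
    by rewrite coef_ser // mulrA -rmorphM mulfV ?fact_neq0 // rmorph1 mul1r.
  apply: eqmodX_trans (ser_expD _ _ _); apply: eqmodXM => //.
  exact: ser_exp_sum.
rewrite umbraCM -mul_mpolyC; congr (_ * _).
rewrite coefM umbra_sum big_split.
transitivity
  (ser (@mpolyC k rat) N exp_coef (powersum k 1) *
   \prod_(i < k) ser (@mpolyC k rat) N bern_coef 'X_i)`_n.
  rewrite coefM; apply: eq_bigr => j _.
  have jN : (j <= N)%N by rewrite (leq_trans _ nN) // -ltnS.
  by rewrite !coef_ser // -umbra_exp_prod -umbraCM rmorphM rmorphXn.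
have {nN} := nN; apply: eqmodXM => //; apply: eqmodX_sym.
by rewrite /powersum; under eq_bigr => i _ do rewrite -[X in ser _ _ _ X]expr1;
  exact: ser_exp_sum.
Qed.

(** * Algebraic independence of the power sums *)

(** Both sides are derivations along p |-> p \mPo t that agree on the variables,
    hence on monomials, hence everywhere. *)
Lemma comp_mpoly_chain (R : comNzRingType) (n k : nat) (i : 'I_k)
    (t : n.-tuple {mpoly R[k]}) (p : {mpoly R[n]}) :
  (p \mPo t)^`M(i) = \sum_(j < n) (p^`M(j) \mPo t) * (tnth t j)^`M(i).
Proof.
pose chain q :=
  (q \mPo t)^`M(i) = \sum_(j < n) (q^`M(j) \mPo t) * (tnth t j)^`M(i).
have chain1 : chain 1.
  rewrite /chain rmorph1 mderivC big1 // => j _.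
  by rewrite mderivC raddf0 mul0r.
have chainM q r : chain q -> chain r -> chain (q * r).
  rewrite /chain (rmorphM (comp_mpoly t)) mderivM => -> ->.
  rewrite mulr_suml mulr_sumr -big_split /=; apply: eq_bigr => j _.
  rewrite mderivM comp_mpolyD !(rmorphM (comp_mpoly t)) /=; ring.
have chainX j : chain 'X_j.
  rewrite /chain (bigD1 j) //= comp_mpolyXU -tnth_nth big1 => [|l lj].
    have -> : ('X_j : {mpoly R[n]})^`M(j) = 1.
      rewrite mderivX mnm1E eqxx scale1r -[X in (X - _)%MM]add0m addmK.
      exact: mpolyX0.
    by rewrite rmorph1 mul1r addr0.
  by rewrite mderivX mnm1E eq_sym (negPf lj) scale0r raddf0 mul0r.
have chainXm m : chain 'X_[m].
  rewrite mpolyXE_id; apply: (big_ind chain) => // j _.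
  elim: (m j) => [|e IHe]; first by rewrite expr0.
  by rewrite exprS; apply: chainM.
elim/mpolyind: p => [|c m p _ _ IHp].
  rewrite raddf0 mderiv0 big1 // => j _.
  by rewrite mderiv0 raddf0 mul0r.
rewrite comp_mpolyD comp_mpolyZ mderivD mderivZ chainXm IHp scaler_sumr.
rewrite -big_split /=; apply: eq_bigr => j _.
by rewrite mderivD mderivZ comp_mpolyD comp_mpolyZ mulrDl scalerAl.
Qed.

Lemma comp_mpolyA (R : comNzRingType) (n m k : nat) (t : n.-tuple {mpoly R[m]})
    (u : m.-tuple {mpoly R[k]}) (p : {mpoly R[n]}) :
  (p \mPo t) \mPo u = p \mPo [tuple tnth t i \mPo u | i < n].
Proof.
rewrite [p \mPo t]comp_mpolyE [RHS]comp_mpolyE raddf_sum.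
apply: eq_bigr => j _; rewrite /= comp_mpolyZ rmorph_prod /=.
congr (_ *: _); apply: eq_bigr => i _.
by rewrite rmorphXn tnth_mktuple.
Qed.

Lemma mderiv_powersum (k j : nat) (i : 'I_k) :
  (powersum k j.+1)^`M(i) = j.+1%:R *: 'X_i ^+ j.
Proof.
rewrite /powersum raddf_sum (bigD1 i) //= big1 ?addr0 => [|l li].
  by rewrite mpolyXn mderivX mulmnE mnm1E eqxx mul1n mulmSr addmK mpolyXn.
by rewrite mpolyXn mderivX mulmnE mnm1E (negPf li) mul0n scale0r.
Qed.

Lemma mnm_neq0 n (m : 'X_{1..n}) : m != 0%MM -> exists i, m i != 0%N.
Proof.
move=> m0; apply/existsP; apply: contraR m0; rewrite negb_exists => /forallP h.
apply/eqP/mnmP=> i; rewrite mnm0E; apply/eqP/negPn; exact: h.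
Qed.

(** Setting all x_i to 0 sets every p_j with j > 0 to 0. *)
Lemma mcoeff0_at_powersums (n k : nat) (Q : {mpoly rat[n]}) :
  (at_powersums k Q)@_0%MM = Q@_0%MM.
Proof.
have p0 j : (powersum k j.+1)@_0%MM = 0.
  rewrite /powersum rmorph_sum big1 // => i _.
  by rewrite rmorphXn /= mcoeffX mnm1_eq0 expr0n.
rewrite [in RHS](mpolyE Q) /at_powersums comp_mpolyE !raddf_sum /=.
apply: eq_bigr => m _; rewrite !mcoeffZ mcoeffX rmorph_prod; congr (_ * _).
have [->|/mnm_neq0[i mi]] := eqVneq m 0%MM.
  by rewrite big1 // => i _; rewrite mnm0E expr0 rmorph1.
rewrite (bigD1 i) //= tnth_mktuple rmorphXn.
by rewrite /= p0 expr0n (negPf mi) mul0r.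
Qed.

(** If Q(p_1, ..., p_n) = 0, the chain rule for d/dx_i says that x_i is a root of
    the polynomial \sum_j (j+1) (d_j Q)(p) t^j, where d_j is the derivative in the
    j-th indeterminate.  Its degree is less than n and it has k >= n distinct roots,
    so each (d_j Q)(p) vanishes.  Induction on the degree of monomials then kills
    all coefficients of Q, the constant one being read off at x = 0. *)
Lemma at_powersums_eq0 (n k : nat) (Q : {mpoly rat[n]}) : (n <= k)%N ->
  at_powersums k Q = 0 -> Q = 0.
Proof.
move=> nk Q0; apply/mpolyP=> m; rewrite mcoeff0.
have [d] := ubnP (mdeg m); elim: d m Q Q0 => // d IHd m Q Q0.
have dQ0 j : at_powersums k Q^`M(j) = 0.
  pose r : {poly {mpoly rat[k]}} :=
    \poly_(j < n) (if insub j is Some j' then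
       j.+1%:R *: at_powersums k Q^`M(j') else 0).
  have r_root (i : 'I_k) : root r 'X_i.
    rewrite /root horner_poly; apply/eqP.
    transitivity (at_powersums k Q)^`M(i); last by rewrite Q0 mderiv0.
    rewrite /at_powersums comp_mpoly_chain.
    apply: eq_bigr => l _; rewrite valK tnth_mktuple mderiv_powersum.
    by rewrite -scalerAl -scalerAr.
  have r0 : r = 0.
    apply/eqP; apply: contraTT nk => rN0; rewrite -ltnNge.
    have := @max_poly_roots _ r [seq 'X_i | i <- enum 'I_k] rN0.
    rewrite size_map size_enum_ord => lt_k.
    apply: leq_trans (lt_k _ _) (size_poly _ _).
      by apply/allP=> _ /mapP[i _ ->].
    rewrite map_inj_uniq ?enum_uniq // => i l /(congr1 (mcoeff U_(l)%MM)).
    by rewrite !mcoeffXU eqxx; case: eqP => // _ /eqP; rewrite eq_sym oner_eq0.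
  have /eqP := congr1 (fun s : {poly _} => s`_j) r0.
  rewrite coef0 coef_poly ltn_ord valK scaler_eq0 pnatr_eq0 /=.
  by move/eqP.
have [-> _ | m0 md] := eqVneq m 0%MM.
  by rewrite -(mcoeff0_at_powersums k) Q0 mcoeff0.
(* Lower m by one variable and use the coefficient of the derivative. *)
have [i mi] := mnm_neq0 m0.
have mE : (m - U_(i) + U_(i))%MM = m by rewrite submK // lep1mP.
have md' : (mdeg (m - U_(i))%MM < d)%N.
  by move: md; rewrite -[X in mdeg X]mE mdegD mdeg1 addn1 ltnS.
have /eqP := IHd _ _ (dQ0 i) md'; rewrite mcoeff_deriv mE mulrn_eq0.
by move/eqP.
Qed.

Lemma at_powersums_inj (n k : nat) : (n <= k)%N ->
  injective (@at_powersums n k).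
Proof.
move=> nk P Q PQ; apply/eqP; rewrite -subr_eq0; apply/eqP.
apply: (at_powersums_eq0 nk); rewrite /at_powersums comp_mpolyB.
by apply/eqP; rewrite subr_eq0; apply/eqP.
Qed.

(** * The recursion satisfied by both generating functions *)

Definition logder_rec (k n : nat) (p h : nat -> {mpoly rat[k]}) : Prop :=
  h 0%N = 1 /\ forall m, (m <= n)%N ->
    h m *+ m = \sum_(j < m.+1) logder_coef j *: (p j * h (m - j)%N).

(** One family Q serves every number of variables and every choice of p, which is
    what allows the same Q to be used for T_n and for f_n. *)
Lemma logder_rec_solution n : exists Q : nat -> {mpoly rat[n]},
  forall k (p h : nat -> {mpoly rat[k]}), logder_rec n p h ->
  forall m, (m <= n)%N -> Q m \mPo [tuple p i.+1 | i < n] = h m.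
Proof.
suff [Q QP] : exists Q : nat -> {mpoly rat[n]},
    forall k (p h : nat -> {mpoly rat[k]}), logder_rec n p h ->
    forall m, (m < n.+1)%N -> Q m \mPo [tuple p i.+1 | i < n] = h m.
  by exists Q.
(* Q is built one value at a time, the bound M growing up to n.+1. *)
have := leqnn n.+1; elim: {1 3}n.+1 => [|M IHM] lM.
  by exists (fun _ => 0).
have [Q QP] := IHM (ltnW lM).
exists (fun m => if m == M then
    if M == 0%N then 1 else M%:R^-1 *:
      \sum_(j < n | (j < M)%N) logder_coef j.+1 *: ('X_j * Q (M - j.+1)%N)
  else Q m).
move=> k p h hrec m; rewrite ltnS leq_eqVlt.
case: eqP => [-> _ | _ /= mM]; last first.
  exact: QP hrec _ mM.
have [h0 hS] := hrec; case: eqP => [-> | /eqP M0]; first by rewrite comp_mpoly1.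
apply: (scalerI (a := M%:R)); first by rewrite pnatr_eq0.
rewrite comp_mpolyZ scalerA mulfV ?pnatr_eq0 // scale1r scaler_nat hS //.
rewrite big_ord_recl logder_coef0 scale0r add0r.
rewrite raddf_sum [RHS](big_ord_widen n (fun j =>
  logder_coef j.+1 *: (p j.+1 * h (M - j.+1)%N))) //.
apply: eq_bigr => j jM; rewrite /= comp_mpolyZ (rmorphM (comp_mpoly _)) /=.
rewrite comp_mpolyXU -tnth_nth tnth_mktuple (QP _ _ _ hrec) //.
by rewrite ltn_subrL /= lt0n.
Qed.

Lemma logder_rec_prod (k n N : nat)
    (D F : 'I_k -> {poly {mpoly rat[k]}})
    (p : nat -> {mpoly rat[k]}) :
  (n <= N)%N ->
  (forall i, (F i)`_0 = 1) ->
  (forall i, logder_rel N (D i) (F i)) ->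
  (forall j, (j <= N)%N -> \sum_i (D i)`_j = logder_coef j *: p j) ->
  logder_rec n p (fun m => (\prod_i F i)`_m).
Proof.
move=> nN F0 DF Dp; split=> [|m mn].
  by rewrite coef0_prod big1.
have mN := leq_trans mn nN.
rewrite -coef_euler_op (@logder_prod _ N _ (index_enum 'I_k) xpredT D F
  (fun i _ => DF i) m mN) coefM.
apply: eq_bigr => j _; rewrite coef_sum Dp ?scalerAl //.
by rewrite (leq_trans _ mN) // -ltnS.
Qed.

Lemma expquo_rec k n N : (n <= N)%N ->
  logder_rec n (powersum k)
    (fun m => (\prod_(i < k) ser (@mpolyC k rat) N expquo_coef 'X_i)`_m).
Proof.
move=> nN; apply: (logder_rec_prod
  (D := fun i => ser (@mpolyC k rat) N logder_coef 'X_i)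
  (F := fun i => ser (@mpolyC k rat) N expquo_coef 'X_i) nN) => [i|i|j jN].
- by rewrite coef_ser // expr0 mulr1 expquo_coef0 rmorph1.
- exact: logder_expquo.
rewrite /powersum scaler_sumr; apply: eq_bigr => i _.
by rewrite coef_ser // mul_mpolyC.
Qed.

(** The sign (-1)^(j-1) is written - (-1)^j so as to make sense at j = 0. *)
Lemma todd_rec k n N : (n <= N)%N ->
  logder_rec n (fun j => - ((-1) ^+ j * powersum k j))
    (fun m => (\prod_(i < k) todd (@mpolyC k rat) N 'X_i)`_m).
Proof.
move=> nN; apply: (logder_rec_prod
  (D := fun i => - ser (@mpolyC k rat) N logder_coef (- 'X_i))
  (F := fun i => todd (@mpolyC k rat) N 'X_i) nN) => [i|i|j jN].
- exact: coef0_todd.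
- exact: logder_todd.
rewrite /powersum mulr_sumr -sumrN scaler_sumr; apply: eq_bigr => i _.
by rewrite coefN coef_ser // mul_mpolyC (exprNn 'X_i) scalerN.
Qed.

Lemma alternate_signsK n : involutive (@alternate_signs n).
Proof.
move=> Q; rewrite /alternate_signs comp_mpolyA -[RHS]comp_mpoly_id.
congr (_ \mPo _); apply: eq_from_tnth => i; rewrite !tnth_mktuple.
rewrite (rmorphM (comp_mpoly _)) rmorph_sign /= comp_mpolyXU -tnth_nth.
by rewrite tnth_mktuple mulrA -expr2 sqrr_sign mul1r.
Qed.

Lemma at_powersums_alternate n k (Q : {mpoly rat[n]}) :
  at_powersums k (alternate_signs Q) =
  Q \mPo [tuple - ((-1) ^+ i.+1 * powersum k i.+1) | i < n].
Proof.
rewrite /alternate_signs /at_powersums comp_mpolyA.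
congr (_ \mPo _); apply: eq_from_tnth => i; rewrite !tnth_mktuple.
rewrite (rmorphM (comp_mpoly _)) rmorph_sign /= comp_mpolyXU -tnth_nth.
by rewrite tnth_mktuple exprS mulN1r mulNr opprK.
Qed.

(** * Identifying the given polynomials *)

Theorem theorem1p5 (n : nat) (n_ge2 : (2 <= n)%N) (Tn fn : {mpoly rat[n]}) :
  expresses_T Tn -> expresses_f fn -> Tn = alternate_signs fn.
Proof.
move=> TnP fnP; have n_gt0 : (0 < n)%N := ltnW n_ge2.
have [Q QP] := logder_rec_solution n.
have TnE : Tn = n`!%:R *: Q n.
  apply: (at_powersums_inj (leqnn n)).
  rewrite (is_T_unique (TnP n n_gt0) (is_T_coef n n_gt0)).
  rewrite /at_powersums comp_mpolyZ.
  by rewrite (QP _ _ _ (expquo_rec n (leq_addr n n))).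
have fnE : fn = alternate_signs (n`!%:R *: Q n).
  apply: (at_powersums_inj (leqnn n)).
  rewrite -fnP // (f_poly_coef n (leqnn n)) at_powersums_alternate comp_mpolyZ.
  by rewrite (QP _ _ _ (todd_rec n (leqnn n))).
by rewrite fnE alternate_signsK.
Qed.
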